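(* Let $G$ be a countably infinite amenable cancellative semigroup. Let $(F_n)_{n\ge 1}$ be a F{\o}lner sequence in $G$ such that for every $\alpha\in(0,1)$ we have $\sum_{n=1}^\infty \alpha^{|F_n|}<\infty$. Then $\lambda$-almost every $x\in\{0,1\}^G$ is $(F_n)$-normal, i.e., for any nonempty finite set $K\subset G$ and any block $B\in\{0,1\}^K$, one has $$\lim_{n\to\infty}\frac1{|F_n|}\,|\{g\in F_n:\sigma_g(x)\in [B]\}|=2^{-|K|}.$$
   Context: A semigroup $G$ is (two-sided) cancellative if $ab=ac\Rightarrow b=c$ and $ba=ca\Rightarrow b=c$. For $g\in G$, $F\subset G$: $g^{-1}F=\{h\in G: gh\in F\}$. A sequence $(F_n)$ of (nonempty) finite subsets of $G$ is a (left) F{\o}lner sequence if $\lim_n |F_n\cap g^{-1}F_n|/|F_n|=1$ for every $g\in G$; no monotonicity or exhaustion of $G$ is required. Amenable means (left) amenable (for such $G$: a left F{\o}lner sequence exists). The semigroup $G$ acts on $\{0,1\}^G$ by $\sigma_g(x)=(x_{hg})_{h\in G}$ for $x=(x_h)_{h\in G}$. For nonempty finite $K\subset G$ and $B\in\{0,1\}^K$, $[B]=\{x\in\{0,1\}^G: x|_K=B\}$. $\lambda$ is the uniform product (Bernoulli) measure $(\frac12,\frac12)^G$ on $\{0,1\}^G$. *)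

(* Defs.v *)
From HB Require Import structures.
From mathcomp Require Import all_boot all_order all_algebra finmap.
From mathcomp Require Import all_classical all_reals all_analysis.
Import Order.TTheory GRing.Theory Num.Theory.
Import numFieldNormedType.Exports.

Set Implicit Arguments.
Unset Strict Implicit.
Unset Printing Implicit Defensive.

Local Open Scope classical_set_scope.
Local Open Scope fset_scope.
Local Open Scope ring_scope.

Definition cancellative (G : semigroupType) : Prop :=
  (forall a b c : G, (a * b = a * c)%g -> b = c) /\
  (forall a b c : G, (b * a = c * a)%g -> b = c).

(* g^{-1}F; in a semigroup this is a preimage, not a translate by an inverse *)
Definition lpreimage (G : semigroupType) (g : G) (F : set G) : set G :=
  [set h | F (g * h)%g].

Definition folner (R : realType) (G : semigroupType) (F : nat -> {fset G}) :
    Prop :=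
  (forall n, F n != fset0) /\
  forall g : G,
    (#|` [fset h in F n | h \in lpreimage g [set` F n]]|%:R / #|` F n|%:R : R)
      @[n --> \oo] --> (1 : R).

(* Left amenability, in its form for countable cancellative semigroups. *)
Definition amenable (R : realType) (G : semigroupType) : Prop :=
  exists F : nat -> {fset G}, folner R F.

Definition coordinate_events (G : Type) : set (set (G -> bool)) :=
  \bigcup_(g in [set: G])
    preimage_set_system [set: G -> bool] (fun x => x g) measurable.

(* {0,1}^G with its product sigma-algebra *)
Definition config (G : Type) := g_sigma_algebraType (@coordinate_events G).

HB.instance Definition _ (G : Type) := Measurable.on (config G).

(* By the pi-lambda theorem at most one probability satisfies this. *)
Definition is_product_measure (R : realType) (G : choiceType)
    (mu : set bool -> \bar R) (lambda : set (config G) -> \bar R) : Prop :=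
  forall (K : {fset G}) (A : G -> set bool),
    lambda [set x | forall k, k \in K -> A k (x k)] =
    (\prod_(k <- K) mu (A k))%E.

Definition uniform_bernoulli (R : realType) (G : choiceType)
    (lambda : set (config G) -> \bar R) : Prop :=
  is_product_measure (bernoulli_prob (2^-1 : R)) lambda.

Definition shift (G : semigroupType) (g : G) (x : config G) : config G :=
  fun h => x (h * g)%g.

Definition cylinder (G : choiceType) (K : {fset G}) (B : {ffun K -> bool}) :
    set (config G) :=
  [set x | forall k : K, x (val k) = B k].

Definition normal (R : realType) (G : semigroupType) (F : nat -> {fset G})
    (x : config G) : Prop :=
  forall (K : {fset G}) (B : {ffun K -> bool}), K != fset0 ->
    (#|` [fset g in F n | shift g x \in cylinder B]|%:R / #|` F n|%:R : R)
      @[n --> \oo] --> (2^-1 ^+ #|` K| : R).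

(* Main.v *)
Require Import Defs.
From mathcomp Require Import all_boot all_order all_algebra finmap.
From mathcomp Require Import all_classical all_reals all_analysis.
From mathcomp Require Import measurable_realfun ring lra.
Import Order.TTheory GRing.Theory Num.Theory.
Import numFieldNormedType.Exports.
Local Open Scope classical_set_scope.
Local Open Scope ring_scope.

Set Implicit Arguments.
Unset Strict Implicit.
Unset Printing Implicit Defensive.

(** Fix a block B on K, with p = 2^-#|K|, and let E_g be the event that B occurs
    at g, that is, x (k g) = B k for all k in K.  By right cancellation the
    coordinates k g are distinct for distinct k, so E_g has probability p, and
    for elements g whose translates K g are pairwise disjoint the events E_g
    are independent ([pattern_product_rule]).

    Translates K g and K h meet only if k g = l h for some k, l in K; by left
    cancellation h is then determined by g, k and l.  Each translate thus meets
    at most #|K|^2 others, and a greedy colouring ([greedy_coloring]) splits any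
    finite set into m = #|K|^2 + 1 classes of pairwise disjoint translates.  If
    the number of occurrences of B in a finite set S differs from p #|S| by at
    least delta #|S|, then some class deviates by at least (delta / m) #|S|, and
    the exponential Markov inequality for independent events bounds the
    probability of this by 2 m exp (- delta^2 #|S| / (8 m^2))
    ([colored_deviation_le]).

    For S = F_n this bound is a constant times alpha^#|F_n| with 0 < alpha < 1,
    so by the growth hypothesis it is summable in n.  By Borel-Cantelli, almost
    surely only finitely many n have a delta-deviation
    ([ae_eventually_small_deviation]).  As G is countable, there are countably
    many triples (K, B, delta = 1/(i+1)), and the union of the exceptional null
    sets is null. *)

(** * Two analytic inequalities *)

(** The inverse of exp (- t) >= 1 - t gives exp t <= 1 / (1 - t), and
    (1 - t) (1 + t + 2 t^2) = 1 + t^2 (1 - 2 t) >= 1 for t <= 1/2.  The range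
    includes all negative t, so the same bound controls both tails. *)
Lemma expR_le_quadratic (R : realType) (t : R) : t <= 2^-1 ->
  expR t <= 1 + t + 2 * t ^+ 2.
Proof.
move=> t2; have t1 : 0 < 1 - t by lra.
have := expR_ge1Dx (- t); rewrite expRN => le_inv.
have : expR t <= (1 - t)^-1.
  by rewrite -[leLHS]invrK lef_pV2 // posrE ?invr_gt0 ?expR_gt0.
move=> /le_trans; apply.
rewrite -[leLHS]mulr1 ler_pdivrMl //.
have := sqr_ge0 t; nra.
Qed.

Lemma markov_inequality d (T : measurableType d) (R : realType)
    (P : probability T R) (A : set T) (a : R) (f : T -> R) :
  measurable A -> measurable_fun setT f -> 0 <= a -> (forall x, 0 <= f x) ->
  (forall x, A x -> a <= f x) ->
  (a%:E * P A <= \int[P]_x (f x)%:E)%E.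
Proof.
move=> mA mf a0 f0 af.
rewrite -(integral_cst P mA a%:E).
apply: (@le_trans _ _ (\int[P]_(x in A) (f x)%:E)%E).
  apply: ge0_le_integral => //.
  - by apply/measurable_EFinP; exact: measurable_funS mf.
apply: ge0_subset_integral => //.
- exact/measurable_EFinP.
- by move=> x _; rewrite lee_fin.
Qed.

(** * Deviations of sums of independent events *)

(** Independence of the events E_i, i in s, all of probability p, encoded by the
    probabilities of finite intersections. *)
Definition product_rule d (T : measurableType d) (R : realType)
    (P : probability T R) (I : eqType) (E : I -> set T) (p : R) (s : seq I) :=
  forall r : seq I, uniq r -> {subset r <= s} ->
    P [set x | forall i, i \in r -> E i x] = (p ^+ size r)%:E.

Section Chernoff.
Context d (T : measurableType d) (R : realType) (P : probability T R).
Context (I : eqType) (E : I -> set T) (p : R).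
Context (mE : forall i, measurable (E i)).

Definition hits (s : seq I) (x : T) : R := \sum_(i <- s) \1_(E i) x.

Lemma measurable_hits s : measurable_fun setT (hits s).
Proof. by apply: measurable_sum => i; exact: measurable_indic. Qed.

Lemma measurable_forall_mem (r : seq I) :
  measurable [set x | forall i, i \in r -> E i x].
Proof.
elim: r => [|i r IH].
  rewrite [X in measurable X](_ : _ = setT) //.
  by apply/seteqP; split.
rewrite [X in measurable X](_ : _ =
  E i `&` [set x | forall i, i \in r -> E i x]); first exact: measurableI.
apply/seteqP; split=> [x /= Ex|x [/= Eix Ex] j].
  by split=> [|j jr]; apply: Ex; rewrite inE ?eqxx ?jr ?orbT.
by rewrite inE => /orP[/eqP->|/Ex].
Qed.

(** The moment generating function of a binomial variable, from the product rule
    alone.  The event over r makes an induction on s possible: splitting the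
    domain along E_i moves i from s to r on one part, and the integral over the
    other part is obtained by subtraction. *)
Lemma integral_expR_hits (t : R) (s r : seq I) : uniq (s ++ r) ->
  product_rule P E p (s ++ r) ->
  (\int[P]_(x in [set x | forall i, i \in r -> E i x]) (expR (t * hits s x))%:E
  = (p ^+ size r * (1 + p * (expR t - 1)) ^+ size s)%:E)%E.
Proof.
elim: s r => [|i s IH] r.
  rewrite cat0s => ur /(_ r ur) prr.
  under eq_integral do rewrite /hits big_nil mulr0 expR0.
  rewrite integral_cst /=; last exact: measurable_forall_mem.
  by rewrite mul1e prr // expr0 mulr1.
move=> usr pr.
have usir : uniq (s ++ i :: r) by rewrite -cat1s uniq_catCA.
have subr : subseq (s ++ r) ((i :: s) ++ r) by exact: subseq_cons.
have perm_sir : perm_eq ((i :: s) ++ r) (s ++ i :: r).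
  by rewrite -(cat1s i r) perm_sym perm_catCA.
pose D := [set x | forall j, j \in r -> E j x].
have mD : measurable D by exact: measurable_forall_mem.
have mDE : measurable (D `&` E i) by exact: measurableI.
have mDC : measurable (D `\` E i) by exact: measurableD.
have mf (u : seq I) A : measurable_fun A (fun x => (expR (t * hits u x))%:E).
  apply/measurable_EFinP/measurable_funTS/measurableT_comp => //.
  by apply: measurable_funM => //; exact: measurable_hits.
have f0 (u : seq I) x : (0 <= (expR (t * hits u x))%:E)%E by rewrite lee_fin expR_ge0.
have split (u : seq I) : (\int[P]_(x in D) (expR (t * hits u x))%:E =
   \int[P]_(x in D `&` E i) (expR (t * hits u x))%:E +
   \int[P]_(x in D `\` E i) (expR (t * hits u x))%:E)%E.
  rewrite -ge0_integral_setU //; first by rewrite setUIDK.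
  by apply/disj_set2P; rewrite setDE setIACA setICr setI0.
have intD : (\int[P]_(x in D) (expR (t * hits s x))%:E =
    (p ^+ size r * (1 + p * (expR t - 1)) ^+ size s)%:E)%E.
  apply: IH; first exact: subseq_uniq usr.
  by move=> q uq qs; apply: pr => // j /qs; apply: (mem_subseq subr).
have intDE : (\int[P]_(x in D `&` E i) (expR (t * hits s x))%:E =
    (p ^+ (size r).+1 * (1 + p * (expR t - 1)) ^+ size s)%:E)%E.
  rewrite -[(size r).+1]/(size (i :: r)) -IH //; last first.
    by move=> q uq qs; apply: pr => // j /qs; rewrite (perm_mem perm_sir).
  congr (integral _ _ _); apply/seteqP; split=> [x [Dx Ex] j|x /= DEx].
    by rewrite inE => /orP[/eqP->|/Dx].
  by split=> [j jr|]; apply: DEx; rewrite inE ?eqxx ?jr ?orbT.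
(* The integrals over D and over its part inside E i are known and finite. *)
have intDC : (\int[P]_(x in D `\` E i) (expR (t * hits s x))%:E =
    (p ^+ size r * (1 - p) * (1 + p * (expR t - 1)) ^+ size s)%:E)%E.
  have := split s; rewrite intD intDE.
  case: (\int[P]_(x in D `\` E i) _)%E => [z| |] //.
  rewrite -EFinD => -[e]; congr EFin; move: e; rewrite exprS; lra.
rewrite -/D split.
rewrite (_ : (\int[P]_(x in D `\` E i) _)%E =
    (\int[P]_(x in D `\` E i) (expR (t * hits s x))%:E)%E); last first.
  apply: eq_integral => x; rewrite inE => -[_ nEx].
  by rewrite /hits big_cons indicE memNset // add0r.
rewrite (_ : (\int[P]_(x in D `&` E i) _)%E =
    (\int[P]_(x in D `&` E i) ((expR t)%:E * (expR (t * hits s x))%:E))%E); last first.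
  apply: eq_integral => x; rewrite inE => -[_ Ex].
  by rewrite /hits big_cons indicE mem_set // mulrDr mulr1 expRD EFinM.
rewrite ge0_integralZl_EFin ?expR_ge0 // intDE intDC -EFinM -EFinD.
congr EFin; rewrite /= !exprS; ring.
Qed.

Definition deviation (s : seq I) (x : T) : R := hits s x - p * (size s)%:R.

Lemma measurable_deviation s : measurable_fun setT (deviation s).
Proof. by apply: measurable_funB => //; exact: measurable_hits. Qed.

Definition large_deviation (delta : R) (s : seq I) : set T :=
  [set x | delta * (size s)%:R <= `|deviation s x|].

Lemma measurable_large_deviation delta s : measurable (large_deviation delta s).
Proof.
rewrite -[X in measurable X]setTI; apply: measurable_fun_le => //.
by apply: measurableT_comp => //; exact: measurable_deviation.
Qed.

(** With q = exp t - 1, the moment generating function (1 + p q)^n is at most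
    exp (n p q), and q <= t + 2 t^2; subtracting the mean cancels the linear
    term. *)
Lemma integral_expR_deviation_le (t : R) (s : seq I) :
  0 <= p <= 1 -> t <= 2^-1 -> uniq s -> product_rule P E p s ->
  (\int[P]_x (expR (t * deviation s x))%:E <=
   (expR (2 * t ^+ 2 * (size s)%:R))%:E)%E.
Proof.
move=> /andP[p0 p1] t2 us ps.
have := @integral_expR_hits t s [::]; rewrite cats0 => /(_ us ps).
rewrite (_ : [set x | forall i, i \in [::] -> E i x] = setT); last first.
  by apply/seteqP; split.
rewrite expr0 mul1r => int_hits.
have -> : (\int[P]_x (expR (t * deviation s x))%:E =
   (expR (- (t * p * (size s)%:R)) * (1 + p * (expR t - 1)) ^+ size s)%:E)%E.
  rewrite EFinM -int_hits -ge0_integralZl_EFin ?expR_ge0 //.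
  - apply: eq_integral => x _; rewrite -EFinM -expRD /deviation.
    by congr (expR _)%:E; ring.
  - apply/measurable_EFinP/measurableT_comp => //.
    by apply: measurable_funM => //; exact: measurable_hits.
rewrite lee_fin.
have et0 : 0 < expR t := expR_gt0 t.
have base_ge0 : 0 <= 1 + p * (expR t - 1) by nra.
have base_le : 1 + p * (expR t - 1) <= expR (t * p + 2 * t ^+ 2).
  apply: le_trans (expR_ge1Dx _) _; rewrite ler_expR.
  have := expR_le_quadratic t2; have := sqr_ge0 t; nra.
have pow_le : (1 + p * (expR t - 1)) ^+ size s <=
    expR ((t * p + 2 * t ^+ 2) * (size s)%:R).
  by rewrite expRM_natr lerXn2r // nnegrE expR_ge0.
apply: le_trans (ler_wpM2l (expR_ge0 _) pow_le) _.
by rewrite -expRD ler_expR; lra.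
Qed.

(** By the triangle inequality some colour class has at least the fraction
    1 / (D + 1) of the total deviation, so independence within the classes
    suffices.  Markov's inequality is applied to Z, the sum of
    exp (t deviation) + exp (- t deviation) over the classes: one variable that
    is large as soon as any class deviates in either direction. *)
Lemma colored_deviation_le (D : nat) (c : I -> 'I_D.+1) (s : seq I) (delta : R) :
  0 <= p <= 1 -> 0 < delta <= 1 -> uniq s ->
  (forall k, product_rule P E p [seq i <- s | c i == k]) ->
  (P (large_deviation delta s) <=
   (2 * D.+1%:R *
     expR (- (delta ^+ 2 / (8 * D.+1%:R ^+ 2)) * (size s)%:R))%:E)%E.
Proof.
move=> p01 /andP[d0 d1] us ps.
pose sc k := [seq i <- s | c i == k].
pose m : R := D.+1%:R.
have m1 : 1 <= m by rewrite ler1n.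
have m0 : 0 < m by lra.
(* This t minimizes the final exponent 2 t^2 n - t delta n / m. *)
pose t := delta / (4 * m).
have t0 : 0 < t by rewrite divr_gt0 //; lra.
have t2 : t <= 2^-1 by rewrite ler_pdivrMr; nra.
have Nt2 : - t <= 2^-1 by lra.
pose n : R := (size s)%:R.
have size_sc k : (size (sc k))%:R <= n.
  by rewrite ler_nat size_filter count_size.
have sum_sc (f : I -> R) : \sum_(i <- s) f i = \sum_k \sum_(i <- sc k) f i.
  rewrite (partition_big c xpredT) //=.
  by apply: eq_bigr => k _; rewrite big_filter.
have dev_sum x : deviation s x = \sum_k deviation (sc k) x.
  rewrite /deviation big_split /= -sum_sc; congr (_ + _).
  rewrite sumrN -mulr_sumr; congr (- (_ * _)).
  have := sum_sc (fun=> 1); rewrite big_const_seq count_predT iter_addr addr0.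
  move=> ->; apply: eq_bigr => k _.
  by rewrite big_const_seq count_predT iter_addr addr0.
pose Z x := \sum_(k < D.+1)
  (expR (t * deviation (sc k) x) + expR ((- t) * deviation (sc k) x)).
have mdev u v : measurable_fun setT (fun x => expR (u * deviation v x)).
  apply: measurableT_comp => //; apply: measurable_funM => //.
  exact: measurable_deviation.
have mZ : measurable_fun setT Z.
  by apply: measurable_sum => k; exact: measurable_funD.
have Z0 x : 0 <= Z x by apply: sumr_ge0 => k _; rewrite addr_ge0 ?expR_ge0.
have int_Z : (\int[P]_x (Z x)%:E <= (2 * m * expR (2 * t ^+ 2 * n))%:E)%E.
  under eq_integral do rewrite /Z -sumEFin.
  rewrite ge0_integral_sum //; last first.
    by move=> k; apply/measurable_EFinP; exact: measurable_funD.
  have -> : (2 * m * expR (2 * t ^+ 2 * n))%:E =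
      (\sum_(k < D.+1) (2 * expR (2 * t ^+ 2 * n))%:E)%E.
    by rewrite sumEFin sumr_const card_ord -mulr_natr -/m; congr EFin; ring.
  apply: lee_sum => k _.
  under eq_integral do rewrite EFinD.
  rewrite ge0_integralD //; try exact/measurable_EFinP.
  rewrite mulrDl mul1r EFinD.
  have t2n : 2 * t ^+ 2 * (size (sc k))%:R <= 2 * t ^+ 2 * n.
    by rewrite ler_wpM2l // mulr_ge0 ?sqr_ge0.
  apply: leeD.
    apply: le_trans (integral_expR_deviation_le p01 t2 (filter_uniq _ us) (ps k)) _.
    by rewrite lee_fin ler_expR.
  apply: le_trans (integral_expR_deviation_le p01 Nt2 (filter_uniq _ us) (ps k)) _.
  by rewrite lee_fin ler_expR sqrrN.
have big_Z x : delta * n <= `|deviation s x| -> expR (t * (delta * n / m)) <= Z x.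
  move=> dev_large.
  have [k dev_k] : exists k, delta * n / m <= `|deviation (sc k) x|.
    apply: contrapT => /forallNP small; move: dev_large; apply/negP; rewrite -ltNge.
    rewrite dev_sum; apply: le_lt_trans (ler_norm_sum _ _ _) _.
    have -> : delta * n = \sum_(k < D.+1) (delta * n / m).
      by rewrite sumr_const card_ord -mulr_natr -/m divfK // gt_eqF.
    apply: ltr_sum; first by apply/hasP; exists ord0; rewrite ?mem_index_enum.
    by move=> k _; rewrite ltNge; apply/negP/small.
  apply: (@le_trans _ _ (expR (t * deviation (sc k) x) +
                         expR ((- t) * deviation (sc k) x))).
    have := expR_ge0 (t * deviation (sc k) x).
    have := expR_ge0 ((- t) * deviation (sc k) x).
    move: dev_k; case: (ger0P (deviation (sc k) x)) => _ dev_k e1 e2.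
      apply: (@le_trans _ _ (expR (t * deviation (sc k) x))); last by lra.
      by rewrite ler_expR ler_pM2l.
    apply: (@le_trans _ _ (expR ((- t) * deviation (sc k) x))); last by lra.
    by rewrite ler_expR mulNr -mulrN ler_pM2l.
  rewrite /Z (bigD1 k) //= lerDl.
  by apply: sumr_ge0 => j _; rewrite addr_ge0 ?expR_ge0.
have markov := markov_inequality P (measurable_large_deviation delta s) mZ
  (expR_ge0 _) Z0 big_Z.
have := le_trans markov int_Z.
rewrite -lee_pdivlMl ?expR_gt0 // => /le_trans; apply.
rewrite -EFinM lee_fin -expRN mulrCA -expRD.
rewrite ler_wpM2l ?mulr_ge0 // ?ler_expR //.
rewrite le_eqVlt; apply/orP; left; apply/eqP.
by rewrite -/n /t; field; rewrite gt_eqF.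
Qed.

End Chernoff.

(** * Colourings, countable conjunctions and Borel-Cantelli *)

(** At most d elements of s are related to the next element x, so one of the d + 1
    colours is not used by any of them and can be given to x. *)
Lemma greedy_coloring (T : eqType) (e : rel T) (d : nat) (s : seq T) :
  symmetric e -> (forall x, x \in s -> (count (e x) s <= d)%N) ->
  exists c : T -> 'I_d.+1,
    {in s &, forall x y, e x y -> c x = c y -> x = y}.
Proof.
move=> e_sym; elim: s => [|x s IH] deg; first by exists (fun=> ord0).
have [|c c_inj] := IH.
  move=> y ys; apply: leq_trans (deg y _); last by rewrite inE ys orbT.
  by rewrite /= leq_addl.
pose used := [seq c y | y <- s & e x y].
have [k k_free] : exists k, k \notin used.
  apply/existsP; rewrite -[[exists _, _]]negbK negb_exists; apply/negP.
  move=> /forallP all_used.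
  suff : (d.+1 <= d)%N by rewrite ltnn.
  have <- : #|used| = d.+1.
    rewrite -[RHS]card_ord; apply: eq_card => k.
    by have := all_used k; rewrite negbK => ->.
  apply: leq_trans (card_size _) _; rewrite size_map size_filter.
  by apply: leq_trans (deg x (mem_head _ _)); rewrite /= leq_addl.
have free y : y \in s -> e x y -> c y != k.
  move=> ys exy; apply: contraNneq k_free => <-.
  by apply: map_f; rewrite mem_filter exy.
exists (fun y => if y == x then k else c y) => y z.
rewrite !inE; have [->|yx] /= := eqVneq y x; have [->|zx] /= := eqVneq z x => //.
- by move=> _ zs xz kz; have := free z zs xz; rewrite kz eqxx.
- by move=> ys _ yx' kz; have := free y ys; rewrite e_sym kz eqxx => /(_ yx').
- by move=> ys zs; exact: c_inj.
Qed.

Lemma ae_forall_countable d (T : measurableType d) (R : realType)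
    (mu : {measure set T -> \bar R}) (I : choiceType) (Q : I -> T -> Prop) :
  countable [set: I] -> (forall i, {ae mu, forall x, Q i x}) ->
  {ae mu, forall x, forall i, Q i x}.
Proof.
move=> /countable_injP[f f_inj] aeQ.
have : {ae mu, forall x, forall n, forall i, f i = n -> Q i x}.
  apply: ae_foralln => n.
  have [[i fi]|nfi] := pselect (exists i, f i = n).
    apply: filterS (aeQ i) => x Qix j; rewrite -fi => /f_inj ->//; exact: in_setT.
  by apply: aeW => x i fi; case: nfi; exists i.
by apply: filterS => x Qx i; exact: Qx (f i) i erefl.
Qed.

Lemma ae_eventually_not d (T : measurableType d) (R : realType)
    (P : probability T R) (L : nat -> set T) :
  (forall n, measurable (L n)) -> (\sum_(n <oo) P (L n) < +oo)%E ->
  {ae P, forall x, \forall n \near \oo, ~ L n x}.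
Proof.
move=> mL sumL; exists (lim_sup_set L); split.
- apply: bigcap_measurable => // n _; exact: bigcup_measurable.
- exact: lim_sup_set_cvg0.
- move=> x /= not_near n _; apply: contrapT => notL; apply: not_near.
  exists n => // k /= nk Lk; apply: notL.
  by exists k.
Qed.

Lemma countable_fset_type (T : choiceType) :
  countable [set: T] -> countable [set: {fset T}].
Proof.
move=> /countable_injP[f f_inj].
apply/countable_injP; exists (fun A => choice.pickle [seq f i | i <- enum_fset A]).
move=> A B _ _ /(pcan_inj choice.pickleK) AB.
have {}AB : enum_fset A = enum_fset B.
  by apply: inj_map AB => x y; apply: f_inj; exact: in_setT.
by apply/fsetP => x; rewrite -[x \in A]/(x \in enum_fset A) AB.
Qed.

(** * Occurrences of a block under the Bernoulli measure *)

Lemma bernoulli_prob_half_set1 (R : realType) (b : bool) :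
  bernoulli_prob (2^-1 : R) [set b] = (2^-1)%:E.
Proof.
rewrite /bernoulli_prob ifT; last by lra.
rewrite fsbig_set1 /bernoulli_pmf; case: b => //.
by congr EFin; lra.
Qed.

Lemma card_fset_filter_sum (R : realType) (T : choiceType) (A : {fset T})
    (Q : pred T) :
  (#|` [fset g in A | Q g]%fset|)%:R = \sum_(g <- A) (Q g)%:R :> R.
Proof.
rewrite -natr_sum; congr _%:R.
have /perm_size -> : perm_eq [fset g in A | Q g]%fset [seq g <- A | Q g].
  apply: uniq_perm; [exact: fset_uniq|exact/filter_uniq/fset_uniq|].
  by move=> g; rewrite !inE mem_filter andbC.
by rewrite size_filter -sum1_count big_mkcond.
Qed.

Section Translates.
Context (R : realType) (G : semigroupType) (G_cancellative : cancellative G).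
Context (lambda : probability (config G) R).
Context (lambda_bernoulli : uniform_bernoulli lambda).
Context (K : {fset G}) (B : {ffun K -> bool}).

Definition pattern_at (g : G) : set (config G) := Defs.shift g @^-1` cylinder B.

Definition overlap (g h : G) : bool :=
  [exists k : K, [exists l : K, (val k * g)%g == (val l * h)%g]].

Lemma measurable_pattern_at g : measurable (pattern_at g).
Proof.
have -> : pattern_at g =
    [set x | forall k : K, k \in enum {: K} -> x (val k * g)%g = B k].
  by apply/seteqP; split=> x Bx k => [_|]; apply: Bx; rewrite mem_enum.
apply: (@measurable_forall_mem _ (config G) K
  (fun k => [set x : config G | x (val k * g)%g = B k])) => k.
apply: sub_sigma_algebra; exists (val k * g)%g => //.
by exists [set B k] => //; rewrite setTI.
Qed.

(** The intersection of the events at g in r fixes the coordinates k g with g in r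
    and k in K.  These are all distinct: disjointness of the translates
    separates different g, right cancellation separates different k.  Hence the
    product formula has size r * #|K| factors, each equal to 1/2. *)
Lemma pattern_product_rule (s : seq G) :
  {in s &, forall g h, overlap g h -> g = h} ->
  product_rule lambda pattern_at (2^-1 ^+ #|` K|) s.
Proof.
move=> s_disj r ur rs.
pose Ls : seq G := [seq (k * g)%g | g <- r, k <- K].
(* At a coordinate l = k g the constraint A l is the singleton of B k; the
   universal quantifier avoids choosing g and k. *)
pose A (l : G) := [set b | forall g (k : K), g \in r -> (val k * g)%g = l -> b = B k].
have uLs : uniq Ls.
  apply: allpairs_uniq => //.
  move=> _ _ /allpairsP[[g k] /= [gr kK ->]] /allpairsP[[h l] /= [hr lK ->]] /= e.
  have gh : g = h.
    apply: s_disj; [exact: rs|exact: rs|].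
    by apply/existsP; exists [` kK]%fset; apply/existsP; exists [` lK]%fset; apply/eqP.
  by move: e; rewrite gh => /(proj2 G_cancellative) ->.
have -> : [set x | forall g, g \in r -> pattern_at g x] =
    [set x : config G | forall l, l \in [fset l in Ls]%fset -> A l (x l)].
  apply/seteqP; split=> [x Ex l _ g k gr <-|x Ax g gr k]; first exact: Ex.
  apply: (Ax (val k * g)%g _ g k gr erefl).
  by rewrite inE; apply: allpairs_f => //; exact: valP.
rewrite lambda_bernoulli.
rewrite (eq_big_seq (fun=> (2^-1 : R)%:E)); last first.
  move=> l; rewrite inE => /allpairsP[[g k] /= [gr kK lE]].
  rewrite (_ : A l = [set B [` kK]%fset]) ?bernoulli_prob_half_set1 //.
  apply/seteqP; split=> [b Ab|b -> h k' hr].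
    exact: (Ab g [` kK]%fset gr).
  rewrite lE => e.
  have hg : h = g.
    apply: s_disj; [exact: rs|exact: rs|].
    by apply/existsP; exists k'; apply/existsP; exists [` kK]%fset; apply/eqP.
  move: e; rewrite hg => /(proj2 G_cancellative) e.
  by congr (B _); apply: val_inj.
rewrite prodEFin big_const_seq count_predT iter_mulr_1.
congr EFin; rewrite -exprM; congr (_ ^+ _).
transitivity (size Ls); last by rewrite size_allpairs mulnC.
by apply/perm_size/uniq_perm => // l; rewrite inE.
Qed.

Lemma overlap_sym : symmetric overlap.
Proof.
by move=> g h; apply/existsP/existsP => -[k /existsP[l /eqP e]];
  exists l; apply/existsP; exists k; apply/eqP.
Qed.

(** Left cancellation: in k g = l h, the elements g, k and l determine h.  So the
    elements h that overlap g are among the values of a function of (k, l). *)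
Lemma overlap_degree (g : G) (s : seq G) :
  uniq s -> (count (overlap g) s <= #|{: K * K}|)%N.
Proof.
move=> us.
pose f (kl : K * K) := xget g [set h | (val kl.1 * g)%g = (val kl.2 * h)%g].
rewrite -size_filter cardE -(size_map f).
apply: uniq_leq_size; first exact: filter_uniq.
move=> h; rewrite mem_filter => /andP[/existsP[k /existsP[l /eqP kl]] _].
apply/mapP; exists (k, l); first by rewrite mem_enum.
rewrite /f; case: xgetP => [h' _ /= e|/(_ h)//].
by apply: (proj1 G_cancellative (val l)); rewrite -kl -e.
Qed.

Lemma pattern_deviation_le (delta : R) (s : seq G) :
  0 < delta <= 1 -> uniq s ->
  (lambda (large_deviation pattern_at (2^-1 ^+ #|` K|) delta s) <=
   (2 * #|{: K * K}|.+1%:R *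
     expR (- (delta ^+ 2 / (8 * #|{: K * K}|.+1%:R ^+ 2)) * (size s)%:R))%:E)%E.
Proof.
move=> delta01 us.
have [c c_inj] := greedy_coloring overlap_sym (fun g _ => overlap_degree g us).
apply: (colored_deviation_le measurable_pattern_at (c := c)) => //.
  by rewrite exprn_ge0 //= exprn_ile1 //; lra.
move=> k; apply: pattern_product_rule => g h.
rewrite !mem_filter => /andP[/eqP gk gs] /andP[/eqP hk hs] gh.
by apply: c_inj; rewrite // gk.
Qed.

End Translates.

(** * Almost sure normality *)

(** The exponential bound for F n is 2 m alpha^#|F n| with
    alpha = exp (- delta^2 / (8 m^2)). *)
Lemma ae_eventually_small_deviation (R : realType) (G : semigroupType)
    (lambda : probability (config G) R) (F : nat -> {fset G})
    (K : {fset G}) (B : {ffun K -> bool}) (delta : R) :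
  cancellative G -> uniform_bernoulli lambda ->
  (forall alpha : R, 0 < alpha < 1 ->
    (\sum_(n <oo) (alpha ^+ #|` F n|)%:E < +oo)%E) ->
  0 < delta <= 1 ->
  {ae lambda, forall x, \forall n \near \oo,
    ~ large_deviation (pattern_at B) (2^-1 ^+ #|` K|) delta (F n) x}.
Proof.
move=> G_canc lambda_bern growth delta01.
apply: ae_eventually_not => [n|].
  by apply: measurable_large_deviation => g; exact: measurable_pattern_at.
pose m : R := #|{: K * K}|.+1%:R.
have m0 : 0 < m by rewrite ltr0n.
pose gamma : R := delta ^+ 2 / (8 * m ^+ 2).
have gamma0 : 0 < gamma.
  by rewrite divr_gt0 ?mulr_gt0 ?exprn_gt0 //; case/andP: delta01.
have alpha01 : 0 < expR (- gamma) < 1 by rewrite expR_gt0 -expR0 ltr_expR oppr_lt0.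
apply: (@le_lt_trans _ _
  (\sum_(n <oo) ((2 * m)%:E * (expR (- gamma) ^+ #|` F n|)%:E))%E).
  apply: lee_nneseries => // n _.
  rewrite -EFinM -expRM_natr.
  exact: (pattern_deviation_le G_canc lambda_bern B delta01 (fset_uniq (F n))).
rewrite nneseriesZl; last by move=> n _; rewrite lee_fin exprn_ge0 ?expR_ge0.
by rewrite lte_mul_pinfty ?growth // lee_fin mulr_ge0 // ltW.
Qed.

Theorem theorem4p2 (R : realType) (G : semigroupType)
    (G_countably_infinite : ([set: G] #= [set: nat])%card)
    (G_cancellative : cancellative G)
    (G_amenable : amenable R G)
    (lambda : probability (config G) R)
    (lambda_bernoulli : uniform_bernoulli lambda)
    (F : nat -> {fset G})
    (F_folner : folner R F)
    (F_growth : forall alpha : R, 0 < alpha < 1 ->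
      (\sum_(n <oo) (alpha ^+ #|` F n|)%:E < +oo)%E) :
  {ae lambda, forall x : config G, normal R F x}.
Proof.
have G_countable : countable [set: G].
  by rewrite (eq_countable G_countably_infinite).
apply: (ae_forall_countable (countable_fset_type G_countable)) => K.
apply: ae_forall_countable => [|B]; first exact: countableP.
have : {ae lambda, forall x, forall i : nat, \forall n \near \oo,
    ~ large_deviation (pattern_at B) (2^-1 ^+ #|` K|) (i.+1%:R^-1 : R) (F n) x}.
  apply: ae_foralln => i; apply: ae_eventually_small_deviation => //.
  by rewrite invr_gt0 ltr0n invf_le1 ?ler1n ?ltr0n.
apply: filterS => x small _.
apply/cvgrPdist_lt => eps eps0.
have [i i_eps] : exists i, i.+1%:R^-1 < eps.
  have [i _ /(_ i)] := near_infty_natSinv_lt (PosNum eps0).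
  by move=> /(_ (leqnn i)); exists i.
apply: filterS (small i) => n /negP; rewrite -ltNge => dev_small.
have Fn0 : 0 < #|` F n|%:R :> R by rewrite ltr0n cardfs_gt0 (proj1 F_folner).
rewrite card_fset_filter_sum distrC.
have -> : (\sum_(g <- F n) (Defs.shift g x \in cylinder B)%:R) =
    @hits _ _ R _ (pattern_at B) (F n) x by [].
apply: lt_trans i_eps; rewrite -(ltr_pM2r Fn0); apply: le_lt_trans dev_small.
rewrite -{2}(gtr0_norm Fn0) -normrM mulrBl divfK // gt_eqF //.
Qed.
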